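(* Let $d\in\mathbb{Z}_{\ge2}$ and let $(\mathbf{R},\le)$ be an ordered field satisfying $[\mathrm{IVT}]_{d^2}$. Let $a,b\in\mathbf{R}$ with $a<b$, $I:=[a,b]$, $n\in\mathbb{Z}_{\ge1}$ and $\sigma,\tau\in\{-1,1\}^{n-1}$. If $(S_0,\dots,S_n)$ is a good Sturm $(\sigma,\tau)$-chain with respect to $I$ and $\deg S_0,\dots,\deg S_n\le d^2$, then $$\mathrm{Ind}_a^b(S_1,S_0)=\mathrm{Var}(\sigma,\tau)_a^b(S_0,\dots,S_n).$$
   Context: For $n\in\mathbb{Z}_{\ge1}$, $[\mathrm{IVT}]_n$ is the property of an ordered field $(\mathbf{R},\le)$: for every $F\in\mathbf{R}[X]$ with $\deg F\le n$ and every $a<b$ in $\mathbf{R}$ with $F(a)F(b)<0$, there is $c\in\mathbf{R}$ with $a<c<b$ and $F(c)=0$. $(\sigma,\tau)$-chains: let $I$ be an interval of $\mathbf{R}$, $n\in\mathbb{Z}_{\ge1}$, $\sigma=(\sigma_1,\dots,\sigma_{n-1}),\tau=(\tau_1,\dots,\tau_{n-1})\in\{-1,1\}^{n-1}$. A sequence $(S_0,\dots,S_n)$ of polynomials in $\mathbf{R}[X]$ is a $(\sigma,\tau)$-chain with respect to $I$ if for $1\le i\le n-1$ there exist $A_i,B_i,C_i\in\mathbf{R}[X]$ such that $A_iS_{i+1}+B_iS_i+C_iS_{i-1}=0$ and, for every $x\in I$, $\mathrm{sign}(A_i(x))=\sigma_i$ and $\mathrm{sign}(C_i(x))=\tau_i$.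 (For $n=1$ the condition is empty.) It is a good Sturm $(\sigma,\tau)$-chain with respect to $I$ if it is a $(\sigma,\tau)$-chain with respect to $I$ and $S_n$ has no root on $I$. Sign variations: $\mathrm{sign}(x)\in\{-1,0,1\}$ is the sign of $x\in\mathbf{R}$. For $P,Q\in\mathbf{R}[X]$, $\mathrm{Var}_x(P,Q)=\frac12|\mathrm{sign}(P(x))-\mathrm{sign}(Q(x))|$ and $\mathrm{Var}_a^b(P,Q)=\mathrm{Var}_a(P,Q)-\mathrm{Var}_b(P,Q)$. For $1\le i\le n$, $\epsilon(\sigma,\tau)_i:=\prod_{1\le j\le i-1}\sigma_j\tau_j$ (so $\epsilon(\sigma,\tau)_1=1$), and $\mathrm{Var}(\sigma,\tau)_a^b(S_0,\dots,S_n):=\sum_{1\le i\le n}\epsilon(\sigma,\tau)_i\,\mathrm{Var}_a^b(S_{i-1},S_i)$. Cauchy index: for $x\in\mathbf{R}$ and $P,Q\in\mathbf{R}[X]\setminus\{0\}$ write uniquely $P=(X-x)^{\mu(x)}\widetilde P$, $Q=(X-x)^{\nu(x)}\widetilde Q$ with $\mu(x),\nu(x)\in\mathbb{Z}_{\ge0}$, $\widetilde P(x)\ne0$, $\widetilde Q(x)\neq0$. Put $\mathrm{Ind}_x^{+}(Q,P)=\frac12\mathrm{sign}(\widetilde Q(x)\widetilde P(x))$ and $\mathrm{Ind}_x^{-}(Q,P)=\frac12(-1)^{\mu(x)-\nu(x)}\mathrm{sign}(\widetilde Q(x)\widetilde P(x))$ if $\mu(x)>\nu(x)$, and both equal to $0$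 otherwise; put $\mathrm{Ind}_x(Q,P)=\mathrm{Ind}_x^+(Q,P)-\mathrm{Ind}_x^-(Q,P)$. For $a<b$ and $P,Q\neq0$, $\mathrm{Ind}_a^b(Q,P)=\mathrm{Ind}_a^+(Q,P)+\sum_{x\in(a,b)}\mathrm{Ind}_x(Q,P)-\mathrm{Ind}_b^-(Q,P)$ (only roots of $P$ in $(a,b)$ contribute). If $a<b$ and $P=0$ or $Q=0$, $\mathrm{Ind}_a^b(Q,P)=0$. *)

(* Defs.v *)
From mathcomp Require Import all_boot all_order all_algebra.
From mathcomp Require Import boolp classical_sets fsbigop set_interval.

Set Implicit Arguments.
Unset Strict Implicit.
Unset Printing Implicit Defensive.
Import Order.TTheory GRing.Theory Num.Theory.
Local Open Scope ring_scope.

(* [deg F <= n] is [size F <= n.+1]; the zero polynomial satisfies it for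
   every n. *)
Definition IVT (R : realFieldType) (n : nat) : Prop :=
  forall (F : {poly R}) (a b : R), (size F <= n.+1)%N ->
    a < b -> F.[a] * F.[b] < 0 -> exists c : R, a < c < b /\ F.[c] = 0.

Section Chains.
Variables (R : realFieldType) (n : nat).
Implicit Types (sigma tau : n.-1.-tuple int) (S : n.+1.-tuple {poly R}).

(* sigma = (sigma_1, ..., sigma_(n-1)) is stored from index 0, so that sigma_i
   is [sigma`_(i.-1)]; likewise for tau.  S = (S_0, ..., S_n) needs no shift. *)
Definition sign_chain sigma tau (I : interval R) S : Prop :=
  forall i : nat, (0 < i < n)%N ->
    exists A B C : {poly R},
      A * S`_(i.+1) + B * S`_i + C * S`_(i.-1) = 0 /\
      forall x : R, x \in I ->
        sgz A.[x] = sigma`_(i.-1) /\ sgz C.[x] = tau`_(i.-1).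

Definition good_sturm_chain sigma tau (I : interval R) S : Prop :=
  sign_chain sigma tau I S /\ forall x : R, x \in I -> ~~ root S`_n x.

Definition var_at (x : R) (P Q : {poly R}) : rat :=
  `|sgz P.[x] - sgz Q.[x]|%:~R / 2.

Definition var_between (a b : R) (P Q : {poly R}) : rat :=
  var_at a P Q - var_at b P Q.

Definition chain_eps sigma tau (i : nat) : int :=
  \prod_(1 <= j < i) (sigma`_(j.-1) * tau`_(j.-1)).

Definition chain_var sigma tau (a b : R) S : rat :=
  \sum_(1 <= i < n.+1)
    (chain_eps sigma tau i)%:~R * var_between a b S`_(i.-1) S`_i.

End Chains.

Section CauchyIndex.
Variable R : realFieldType.
Implicit Types (x a b : R) (P Q : {poly R}).

(* The factor P~ in P = ('X - x)^mu * P~, with mu = mup x P; it does not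
   vanish at x when P != 0. *)
Definition xfree x P : {poly R} := P %/ ('X - x%:P) ^+ mup x P.

Definition ind_right x Q P : rat :=
  if (mup x Q < mup x P)%N
  then (sgz ((xfree x Q).[x] * (xfree x P).[x]))%:~R / 2 else 0.

Definition ind_left x Q P : rat :=
  if (mup x Q < mup x P)%N
  then (-1) ^+ (mup x P - mup x Q)
         * (sgz ((xfree x Q).[x] * (xfree x P).[x]))%:~R / 2 else 0.

Definition ind_at x Q P : rat := ind_right x Q P - ind_left x Q P.

(* The sum is finitely supported: [ind_at x Q P] vanishes unless x is a root
   of P. *)
Definition cauchy_index a b Q P : rat :=
  if (P == 0) || (Q == 0) then 0
  else ind_right a Q P + \sum_(x \in `]a, b[%classic) ind_at x Q P
       - ind_left b Q P.

End CauchyIndex.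

(* Main.v *)
Require Import Defs.
From mathcomp Require Import all_boot all_order all_algebra.
From mathcomp Require Import classical_sets fsbigop.
From mathcomp Require Import boolp ring lra.

(** The heart is the inversion formula Ind(Q,P) + Ind(P,Q) = Var(P,Q) on [[a, b]],
    for [P], [Q] of degree at most [N] without common root.  With the signs of
    [P] and [Q] just to the right (left) of [x] one forms a right (left)
    variation at [x]; then Ind_x^+(Q,P) + Ind_x^+(P,Q) is Var_x(P,Q) minus the
    right variation, and similarly on the left.  Between consecutive roots of
    [P * Q] these one-sided variations agree, by IVT applied to [P] and [Q]
    separately (their product may have too large a degree), so the sum over
    the roots telescopes.  Along the chain, the relation at a root of [S_i]
    gives Ind(S_(i-1), S_i) = - sigma_i tau_i Ind(S_(i+1), S_i), and
    Ind(S_(n-1), S_n) = 0. *)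

Set Implicit Arguments.
Unset Strict Implicit.
Unset Printing Implicit Defensive.
Import Order.TTheory GRing.Theory Num.Theory.
Local Open Scope ring_scope.

(** * Signs of a polynomial on either side of a point *)

Section LocalSigns.
Variable R : realFieldType.
Implicit Types (x y a b : R) (P Q H : {poly R}).

Lemma xfreeE x P : P != 0 -> P = xfree x P * ('X - x%:P) ^+ mup x P.
Proof. by move=> P0; rewrite /xfree divpK // -mup_geq. Qed.

Lemma xfree_neq0 x P : P != 0 -> (xfree x P).[x] != 0.
Proof.
move=> P0; apply/negP; rewrite -/(root _ _) root_factor_theorem => /dvdpP[q Eq].
have := mup_leq x (mup x P) P0; rewrite leqnn => /esym/negP; apply.
by apply/dvdpP; exists q; rewrite {1}(xfreeE x P0) Eq exprS mulrA.
Qed.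

(** Reads [mup] and [xfree] off an explicit factorization. *)
Lemma mup_xfree_unique x H m : H.[x] != 0 ->
  mup x (H * ('X - x%:P) ^+ m) = m /\ xfree x (H * ('X - x%:P) ^+ m) = H.
Proof.
move=> Hx; have Em : mup x (H * ('X - x%:P) ^+ m) = m.
  by rewrite mupMr // mup_XsubCX eqxx.
by split=> //; rewrite /xfree Em mulpK // expf_neq0 // polyXsubC_eq0.
Qed.

Lemma xfreeNroot x P : ~~ root P x -> xfree x P = P.
Proof. by move=> Px; rewrite /xfree mupNroot // divp1. Qed.

(** For [P != 0], the sign of [P] just to the right of [x]: the removed factor, a power of ['X - x],
    is positive there. To the left it has the sign [(-1) ^+ mup x P], whence [left_sign]. *)
Definition right_sign x P : int := sgz (xfree x P).[x].

Definition left_sign x P : int := (-1) ^+ mup x P * right_sign x P.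

Lemma right_signNroot x P : ~~ root P x -> right_sign x P = sgz P.[x].
Proof. by move=> Px; rewrite /right_sign xfreeNroot. Qed.

Lemma left_signNroot x P : ~~ root P x -> left_sign x P = sgz P.[x].
Proof. by move=> Px; rewrite /left_sign mupNroot // mul1r right_signNroot. Qed.

Lemma sgz_pm1 x : x != 0 -> sgz x = 1 \/ sgz x = -1.
Proof. by case: sgzP => //; [left | right]. Qed.

Lemma right_sign_pm1 x P : P != 0 -> right_sign x P = 1 \/ right_sign x P = -1.
Proof. by move=> P0; apply: sgz_pm1; apply: xfree_neq0. Qed.

Lemma left_sign_pm1 x P : P != 0 -> left_sign x P = 1 \/ left_sign x P = -1.
Proof.
move=> P0; rewrite /left_sign -signr_odd.
by case: (right_sign_pm1 x P0) => ->; case: odd;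
  rewrite ?expr0 ?expr1 ?mul1r ?mulN1r ?opprK; auto.
Qed.

(* Cancelling all the factors of [P] at [x] and [y] leaves a polynomial of
   smaller degree without roots on [[x, y]], to which IVT applies: no
   continuity argument near [x] or [y] is needed. *)
Lemma IVT_left_right_sign N x y P : IVT R N -> (size P <= N.+1)%N -> P != 0 ->
  x < y -> (forall z, x < z < y -> ~~ root P z) ->
  right_sign x P = left_sign y P.
Proof.
move=> ivt sP P0 xy noroot.
have Px := xfree_neq0 x P0.
have Q0 : xfree x P != 0 by apply: contraNneq Px => ->; rewrite horner0.
have := xfreeE x P0; have := xfreeE y Q0; have := xfree_neq0 y Q0.
set m := mup x P; set n := mup y (xfree x P); set H := xfree y (xfree x P).
move=> Hy EQ EP.
have Hx : H.[x] != 0.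
  by apply: contraNneq Px => Hx0; rewrite EQ hornerM Hx0 mul0r.
have sH : (size H <= N.+1)%N.
  apply: leq_trans sP; apply: dvdp_leq => //.
  by rewrite EP EQ -mulrA dvdp_mulr.
have EP' : P = (H * ('X - x%:P) ^+ m) * ('X - y%:P) ^+ n.
  by rewrite {1}EP EQ mulrAC.
have yx0 : 0 < y - x by rewrite subr_gt0.
have [Emy Efy] : mup y P = n /\ xfree y P = H * ('X - x%:P) ^+ m.
  rewrite EP'; apply: mup_xfree_unique.
  by rewrite !hornerE mulf_neq0 // expf_neq0 // gt_eqF.
(* If the signs differed, IVT would give a root of [H], hence of [P], strictly between [x] and
   [y]. *)
have sHxy : sgz H.[x] = sgz H.[y].
  apply/eqP/negPn/negP => neq.
  have lt0 : H.[x] * H.[y] < 0.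
    rewrite -sgz_lt0 sgzM; move: neq.
    by case: (sgz_pm1 Hx) => ->; case: (sgz_pm1 Hy) => ->.
  have [c [cxy Hc]] := ivt H x y sH xy lt0.
  have /negP := noroot c cxy; apply.
  by rewrite /root EP' !hornerM Hc !mul0r.
rewrite /left_sign /right_sign Emy Efy EQ !hornerE.
(* [(x - y) ^+ n] supplies the parity sign of [left_sign y P], while [(y - x) ^+ m] is positive. *)
rewrite !sgzM !sgzX sHxy -(opprB y x) sgzN (gtr0_sgz yx0).
by rewrite expr1n mulr1 mulrC.
Qed.

(** * Half-indices and one-sided variations at a point *)

Definition no_common_root (I : interval R) P Q : Prop :=
  forall x, x \in I -> ~~ (root P x && root Q x).

Lemma no_common_rootC I P Q : no_common_root I P Q -> no_common_root I Q P.
Proof. by move=> PQ x /PQ; rewrite andbC. Qed.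

Lemma ind_rightNroot x Q P : ~~ root P x -> ind_right x Q P = 0.
Proof. by move=> Px; rewrite /ind_right (mupNroot Px). Qed.

Lemma ind_leftNroot x Q P : ~~ root P x -> ind_left x Q P = 0.
Proof. by move=> Px; rewrite /ind_left (mupNroot Px). Qed.

Lemma ind_atNroot x Q P : ~~ root P x -> ind_at x Q P = 0.
Proof. by move=> Px; rewrite /ind_at ind_rightNroot // ind_leftNroot ?subr0. Qed.

Lemma mup_gt0 x P : P != 0 -> (0 < mup x P)%N = root P x.
Proof. by move=> P0; rewrite -XsubC_dvd // root_factor_theorem. Qed.

Lemma ind_right_root x Q P : P != 0 -> root P x -> ~~ root Q x ->
  ind_right x Q P = (right_sign x P * right_sign x Q)%:~R / 2.
Proof.
move=> P0 Px Qx; rewrite /ind_right (mupNroot Qx) mup_gt0 // Px.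
by rewrite /right_sign sgzM [X in X%:~R]mulrC.
Qed.

Lemma ind_left_root x Q P : P != 0 -> root P x -> ~~ root Q x ->
  ind_left x Q P = (left_sign x P * left_sign x Q)%:~R / 2.
Proof.
move=> P0 Px Qx; rewrite /ind_left (mupNroot Qx) mup_gt0 // Px subn0.
rewrite /left_sign /right_sign (mupNroot Qx) sgzM mul1r !intrM rmorphXn /= rmorphN1.
by rewrite [(sgz _)%:~R * _]mulrC mulrA.
Qed.

(** For nonzero [P] and [Q], 1 if the one-sided signs differ and 0 if they agree: the value of
    [var_at] just to the right of [x]. *)
Definition right_var x P Q : rat :=
  (1 - (right_sign x P * right_sign x Q)%:~R) / 2.

Definition left_var x P Q : rat :=
  (1 - (left_sign x P * left_sign x Q)%:~R) / 2.

Lemma var_atC x P Q : var_at x P Q = var_at x Q P.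
Proof. by rewrite /var_at distrC. Qed.

(** By symmetry let [Q] not vanish at [x]. If [P] does, then [var_at] is 1/2 and, with s the product
    of the right signs, the identity reads s/2 = 1/2 - (1 - s)/2. Otherwise both sides are 0. *)
Lemma ind_right_var x P Q : P != 0 -> Q != 0 -> ~~ (root P x && root Q x) ->
  ind_right x Q P + ind_right x P Q = var_at x P Q - right_var x P Q.
Proof.
suff main A B : A != 0 -> ~~ root B x ->
    ind_right x B A + ind_right x A B = var_at x A B - right_var x A B.
  move=> P0 Q0; rewrite negb_and => /orP[Px | Qx]; last exact: main.
  by rewrite addrC main // var_atC /right_var [X in X%:~R]mulrC.
move=> A0 Bx; rewrite [ind_right x A B]ind_rightNroot // addr0.
have [Ax | Ax] := boolP (root A x).
  rewrite ind_right_root // /var_at /right_var (rootP Ax) sgz0 sub0r normrN.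
  rewrite (right_signNroot Bx).
  by case: (sgz_pm1 Bx) => ->; case: (right_sign_pm1 x A0) => ->.
rewrite ind_rightNroot // /var_at /right_var !right_signNroot //.
by case: (sgz_pm1 Bx) => ->; case: (sgz_pm1 Ax) => ->.
Qed.

Lemma ind_left_var x P Q : P != 0 -> Q != 0 -> ~~ (root P x && root Q x) ->
  ind_left x Q P + ind_left x P Q = var_at x P Q - left_var x P Q.
Proof.
suff main A B : A != 0 -> ~~ root B x ->
    ind_left x B A + ind_left x A B = var_at x A B - left_var x A B.
  move=> P0 Q0; rewrite negb_and => /orP[Px | Qx]; last exact: main.
  by rewrite addrC main // var_atC /left_var [X in X%:~R]mulrC.
move=> A0 Bx; rewrite [ind_left x A B]ind_leftNroot // addr0.
have [Ax | Ax] := boolP (root A x).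
  rewrite ind_left_root // /var_at /left_var (rootP Ax) sgz0 sub0r normrN.
  rewrite (left_signNroot Bx).
  by case: (sgz_pm1 Bx) => ->; case: (left_sign_pm1 x A0) => ->.
rewrite ind_leftNroot // /var_at /left_var !left_signNroot //.
by case: (sgz_pm1 Bx) => ->; case: (sgz_pm1 Ax) => ->.
Qed.

(** * Sums over the roots in an interval *)

Lemma var_telescope N P Q : IVT R N -> P != 0 -> Q != 0 ->
  (size P <= N.+1)%N -> (size Q <= N.+1)%N ->
  forall (s : seq R) a b, path <%R a (rcons s b) ->
    (forall z, a < z < b -> root (P * Q) z -> z \in s) ->
  right_var a P Q + \sum_(x <- s) (right_var x P Q - left_var x P Q)
    = left_var b P Q.
Proof.
move=> ivt P0 Q0 sP sQ.
have step a b : a < b -> (forall z, a < z < b -> ~~ root (P * Q) z) ->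
    right_var a P Q = left_var b P Q.
  move=> ab noroot; rewrite /right_var /left_var.
  rewrite !(IVT_left_right_sign ivt _ _ ab) // => z /noroot;
    by rewrite rootM negb_or => /andP[].
(* Induction moves the left endpoint to the first point [x] of the list: the variation to the right
   of [a] cancels the one to the left of [x]. *)
elim=> [|x s IHs] a b /= /andP[ab pth] roots.
  rewrite big_nil addr0; apply: step => // z zab.
  by apply/negP => /roots; rewrite in_nil => /(_ zab).
have xb : x < b.
  move: pth; rewrite lt_path_sortedE all_rcons => /andP[/andP[]] //.
have lt_xs : all (> x) s.
  by move: pth; rewrite lt_path_sortedE all_rcons => /andP[/andP[]].
rewrite big_cons (step a x) //; last first.
  move=> z /andP[az zx]; apply/negP => rz.
  have: z \in x :: s by apply: roots; rewrite // az (lt_trans zx).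
  rewrite inE (lt_eqF zx) /= => /(allP lt_xs).
  by rewrite ltNge (ltW zx).
rewrite -(IHs x b) //; first by ring.
move=> z /andP[xz zb] rz.
have: z \in x :: s by apply: roots; rewrite // zb (lt_trans ab).
by rewrite inE (gt_eqF xz).
Qed.

(** Each root splits off a linear factor and lowers the size; whether a root exists is decided
    classically. *)
Lemma roots_in_seq P : P != 0 -> exists s : seq R, forall x, root P x -> x \in s.
Proof.
have [n] := ubnP (size P); elim: n P => // n IHn P sP P0.
have [[x Px] | noroot] := pselect (exists x, root P x); last first.
  by exists [::] => x Px; case: noroot; exists x.
have /factor_theorem[Q EP] := Px.
have Q0 : Q != 0 by apply: contraNneq P0 => Q0; rewrite EP Q0 mul0r.
have [|s rs] := IHn Q _ Q0.
  by move: sP; rewrite EP size_Mmonic ?monicXsubC // size_XsubC addn2.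
exists (x :: s) => y; rewrite EP rootM root_XsubC inE => /orP[/rs -> | ->] //.
by rewrite orbT.
Qed.

Lemma sorted_roots_oo P a b : P != 0 -> a < b -> exists s : seq R,
  [/\ path <%R a (rcons s b), uniq s,
      forall x, x \in s -> a < x < b &
      forall x, a < x < b -> root P x -> x \in s].
Proof.
move=> P0 ab; have [s0 rs] := roots_in_seq P0.
pose s := sort <=%R [seq x <- undup s0 | a < x < b].
have ms x : (x \in s) = (a < x < b) && (x \in s0).
  by rewrite mem_sort mem_filter mem_undup.
have us : uniq s by rewrite sort_uniq filter_uniq // undup_uniq.
exists s; split => //.
- rewrite rcons_path lt_path_sortedE sort_lt_sorted filter_uniq ?undup_uniq //.
  rewrite andbT; apply/andP; split.
    by apply/allP => x; rewrite ms => /andP[/andP[]].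
  (* The last point before [b] is [a] itself or an element of [s]. *)
  by have := mem_last a s; rewrite inE ms => /orP[/eqP -> | /andP[/andP[]]].
- by move=> x; rewrite ms => /andP[].
- by move=> x xab /rs xs; rewrite ms xab.
Qed.

(** Points of [s] that are not roots of [P] contribute 0, so one list of roots of [P * Q] serves
    both indices of the inversion formula. *)
Lemma cauchy_indexE a b P Q (s : seq R) : P != 0 ->
  no_common_root `[a, b] P Q -> a < b -> uniq s ->
  (forall x, x \in s -> a < x < b) ->
  (forall x, a < x < b -> root P x -> x \in s) ->
  cauchy_index a b Q P =
    ind_right a Q P + \sum_(x <- s) ind_at x Q P - ind_left b Q P.
Proof.
move=> P0 PQ ab us sab roots.
have sumE : \sum_(x \in `]a, b[%classic) ind_at x Q P = \sum_(x <- s) ind_at x Q P.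
  rewrite [RHS]fsbig_seq //; symmetry; apply: fsbig_widen.
    by move=> x /= /sab; rewrite in_itv.
  move=> x [/=]; rewrite in_itv /= => xab /negP xs.
  by apply: ind_atNroot; apply: contra xs; apply: roots.
(* If [Q = 0], the index is 0 by convention; [P] then has no root on the interval, so the right-hand
   side is 0 too. *)
rewrite /cauchy_index (negPf P0) sumE /=; case: eqP => // Q0.
have Px x : a <= x <= b -> ~~ root P x.
  move=> xab; have := PQ x; rewrite in_itv /= xab Q0 root0 andbT.
  exact.
rewrite ind_rightNroot ?Px ?lexx ?ltW // ind_leftNroot ?Px ?lexx ?ltW //.
rewrite big_seq big1 ?addr0 ?subr0 // => x /sab/andP[ax xb].
by rewrite ind_atNroot // Px // !ltW.
Qed.

Lemma cauchy_index_inversion N a b P Q : IVT R N -> a < b ->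
  (size P <= N.+1)%N -> (size Q <= N.+1)%N ->
  no_common_root `[a, b] P Q ->
  cauchy_index a b Q P + cauchy_index a b P Q = var_between a b P Q.
Proof.
move=> ivt ab sP sQ PQ.
have aab : a \in `[a, b] by rewrite in_itv /= lexx ltW.
have bab : b \in `[a, b] by rewrite in_itv /= lexx ltW.
(* If one polynomial is 0, the other has no root on the interval: the variation is 1/2 at both
   ends. *)
have degenerate A B : A = 0 -> no_common_root `[a, b] A B ->
    var_between a b A B = 0.
  move=> -> AB; rewrite /var_between /var_at !horner0 sgz0 !sub0r !normrN.
  have Bx x : x \in `[a, b] -> B.[x] != 0.
    by move=> /AB; rewrite root0.
  by case: (sgz_pm1 (Bx _ aab)) => ->; case: (sgz_pm1 (Bx _ bab)) => ->.
have [P0 | P0] := eqVneq P 0.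
  by rewrite degenerate // /cauchy_index P0 eqxx orbT addr0.
have [Q0 | Q0] := eqVneq Q 0.
  rewrite /var_between !(var_atC _ P) -/(var_between a b Q P).
  rewrite degenerate //; last exact: no_common_rootC.
  by rewrite /cauchy_index Q0 eqxx orbT addr0.
have [s [pth us sab roots]] := sorted_roots_oo (mulf_neq0 P0 Q0) ab.
rewrite (cauchy_indexE P0 PQ ab us sab) ?(cauchy_indexE Q0 _ ab us sab).
- have Ea := ind_right_var P0 Q0 (PQ a aab).
  have Eb := ind_left_var P0 Q0 (PQ b bab).
  have Et := var_telescope ivt P0 Q0 sP sQ pth roots.
  (* At an interior point [var_at] cancels between the two sides, leaving the jump of the one-sided
     variations. *)
  have Es : \sum_(x <- s) ind_at x Q P + \sum_(x <- s) ind_at x P Q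
      = - \sum_(x <- s) (right_var x P Q - left_var x P Q).
    rewrite -big_split /= -sumrN big_seq [RHS]big_seq; apply: eq_bigr => x.
    move=> /sab /andP[ax xb]; have xI : x \in `[a, b] by rewrite in_itv /= !ltW.
    have := ind_right_var P0 Q0 (PQ x xI); have := ind_left_var P0 Q0 (PQ x xI).
    by rewrite /ind_at; lra.
  by rewrite /var_between; lra.
- exact: no_common_rootC.
- by move=> x xab rx; apply: roots => //; rewrite rootM rx orbT.
- by move=> x xab rx; apply: roots => //; rewrite rootM rx.
Qed.

(** At a root of the denominator, the half-indices depend on a nonvanishing numerator only through
    its sign; [e != 0] keeps [Q'] from vanishing there. *)
Lemma cauchy_index_sign a b P Q Q' (e : int) : a < b -> e != 0 ->
  (forall x, x \in `[a, b] -> root P x ->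
     ~~ root Q x /\ sgz Q'.[x] = e * sgz Q.[x]) ->
  cauchy_index a b Q' P = e%:~R * cauchy_index a b Q P.
Proof.
move=> ab e0 rel; have [P0 | P0] := eqVneq P 0.
  by rewrite /cauchy_index P0 eqxx mulr0.
have PQ : no_common_root `[a, b] P Q.
  by move=> x xI; apply/negP => /andP[/(rel x xI)[/negP]].
have rel' x : x \in `[a, b] -> root P x -> ~~ root Q' x.
  move=> xI Px; have [Qx EQ] := rel x xI Px.
  by rewrite /root -sgz_eq0 EQ mulf_neq0 // sgz_eq0.
have PQ' : no_common_root `[a, b] P Q'.
  by move=> x xI; apply/negP => /andP[/(rel' x xI) /negP].
have [s [_ us sab roots]] := sorted_roots_oo P0 ab.
have Eright x : x \in `[a, b] -> ind_right x Q' P = e%:~R * ind_right x Q P.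
  move=> xI; have [Px | Px] := boolP (root P x); last first.
    by rewrite !ind_rightNroot // mulr0.
  have [Qx EQ] := rel x xI Px; have Q'x := rel' x xI Px.
  rewrite !ind_right_root // (right_signNroot Qx) (right_signNroot Q'x) EQ.
  by rewrite !intrM; ring.
have Eleft x : x \in `[a, b] -> ind_left x Q' P = e%:~R * ind_left x Q P.
  move=> xI; have [Px | Px] := boolP (root P x); last first.
    by rewrite !ind_leftNroot // mulr0.
  have [Qx EQ] := rel x xI Px; have Q'x := rel' x xI Px.
  rewrite !ind_left_root // (left_signNroot Qx) (left_signNroot Q'x) EQ.
  by rewrite !intrM; ring.
rewrite !(cauchy_indexE P0 _ ab us sab) //.
rewrite Eright ?Eleft ?in_itv /= ?lexx ?ltW //.
rewrite mulrBr mulrDr mulr_sumr; congr (_ + _ - _).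
rewrite big_seq [RHS]big_seq; apply: eq_bigr => x /sab /andP[ax xb].
have xI : x \in `[a, b] by rewrite in_itv /= !ltW.
by rewrite /ind_at Eright // Eleft // mulrBr.
Qed.

Lemma cauchy_indexNroot a b P Q : a < b ->
  (forall x, x \in `[a, b] -> ~~ root P x) -> cauchy_index a b Q P = 0.
Proof.
move=> ab Px; have P0 : P != 0.
  have aI : a \in `[a, b] by rewrite in_itv /= lexx ltW.
  by apply: contraNneq (Px a aI) => ->; rewrite root0.
have PQ : no_common_root `[a, b] P Q by move=> x /Px /negPf ->.
rewrite (cauchy_indexE P0 PQ ab (s := [::])) // => [|x /andP[ax xb]]; last first.
  by rewrite (negPf (Px x _)) // in_itv /= !ltW.
rewrite ind_rightNroot ?Px ?in_itv /= ?lexx ?ltW //.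
by rewrite ind_leftNroot ?Px ?in_itv /= ?lexx ?ltW // big_nil addr0 subr0.
Qed.

End LocalSigns.

(** * Consecutive terms of a good Sturm chain *)

Section Chain.
Variables (R : realFieldType) (n : nat) (sigma tau : n.-1.-tuple int).
Hypothesis hsigma : {subset sigma <= [:: -1; 1]}.
Hypothesis htau : {subset tau <= [:: -1; 1]}.

(** The tuple has [n.-1] entries, so the bound keeps [i] in range; beyond it the default value 0
    would be read. *)
Lemma sign_nth (t : n.-1.-tuple int) i : {subset t <= [:: -1; 1]} ->
  (i.+1 < n)%N -> t`_i = 1 \/ t`_i = -1.
Proof.
move=> ht lin; have := ht t`_i; rewrite !inE => H.
have /H/orP[/eqP -> | /eqP ->] : t`_i \in t; [|by right|by left].
by apply: mem_nth; rewrite size_tuple; case: n lin.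
Qed.

(** As A does not vanish on [I], the relation carries a common root of two consecutive terms up to
    the next pair, and finally to the last term, which has no root on [I]. *)
Lemma sturm_no_common_root (I : interval R) (S : n.+1.-tuple {poly R}) i :
  good_sturm_chain sigma tau I S -> (i < n)%N ->
  no_common_root I S`_i S`_i.+1.
Proof.
move=> [chain last] lin x xI; apply/negP => /andP[ri ri1].
have H k : (i + k < n)%N -> root S`_(i + k) x /\ root S`_(i + k).+1 x.
  elim: k => [|k IHk]; first by rewrite addn0.
  rewrite addnS => lt; have [rk rk1] := IHk (ltnW lt); split=> //.
  have [A [B [C [E sgn]]]] := chain (i + k).+1 lt.
  have [sA _] := sgn x xI.
  have A0 : A.[x] != 0.
    rewrite -sgz_eq0 sA /=.
    by case: (sign_nth hsigma (i := i + k) lt) => ->.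
  move: (congr1 (horner^~ x) E); rewrite /= !hornerE.
  rewrite (rootP rk) (rootP rk1) !mulr0 !addr0 => /eqP.
  by rewrite mulf_eq0 (negPf A0).
(* This choice of [k] makes [(i + k).+1] equal to [n]. *)
have [|_] := H (n.-1 - i)%N; first by rewrite subnKC; case: n lin.
rewrite subnKC; last by case: n lin.
by rewrite (ltn_predK lin); apply/negP/last.
Qed.

Lemma sturm_step (S : n.+1.-tuple {poly R}) a b i : a < b ->
  good_sturm_chain sigma tau `[a, b] S -> (i.+1 < n)%N ->
  cauchy_index a b S`_i S`_i.+1 =
    - (sigma`_i * tau`_i)%:~R * cauchy_index a b S`_i.+2 S`_i.+1.
Proof.
move=> ab hS lin; rewrite -rmorphN.
have [chain _] := hS; have [A [B [C [E sgn]]]] := chain i.+1 lin.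
have pms := sign_nth hsigma lin; have pmt := sign_nth htau lin.
apply: cauchy_index_sign => //.
  by case: pms => ->; case: pmt => ->.
move=> x xI r1; have [/= sA sC] := sgn x xI; split.
  by have := sturm_no_common_root hS lin xI; rewrite r1.
(* At a root of the middle term the relation reads A S_(i+2) = - C S_i; comparing signs gives the
   factor, since the signs of A and C are 1 or -1. *)
move: (congr1 (horner^~ x) E); rewrite /= !hornerE (rootP r1) mulr0 addr0.
move/eqP; rewrite addr_eq0 => /eqP /(congr1 (@sgz R)).
rewrite sgzN !sgzM sA sC.
by case: pms => ->; case: pmt => ->; lra.
Qed.

End Chain.

Theorem corollary35 (d : nat) (hd : (2 <= d)%N)
  (R : realFieldType) (hR : IVT R (d ^ 2)) (a b : R) (hab : a < b)
  (n : nat) (hn : (1 <= n)%N) (sigma tau : n.-1.-tuple int)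
  (hsigma : {subset sigma <= [:: -1; 1]}) (htau : {subset tau <= [:: -1; 1]})
  (S : n.+1.-tuple {poly R})
  (hS : good_sturm_chain sigma tau `[a, b] S)
  (hdeg : forall i : nat, (i <= n)%N -> (size (S`_i)%R <= (d ^ 2).+1)%N) :
  cauchy_index a b S`_1 S`_0 = chain_var sigma tau a b S.
Proof.
have inv i : (i < n)%N -> cauchy_index a b S`_i.+1 S`_i =
    var_between a b S`_i S`_i.+1 - cauchy_index a b S`_i S`_i.+1.
  move=> lin; apply/eqP; rewrite eq_sym subr_eq; apply/eqP.
  rewrite -(cauchy_index_inversion hR hab) // ?hdeg // ?(ltnW lin) //.
  exact: sturm_no_common_root hS lin.
(* After [m] rounds of inversion and chain step, one index remains. *)
have partial m : (m < n)%N -> cauchy_index a b S`_1 S`_0 =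
    \sum_(1 <= i < m.+1)
      (chain_eps sigma tau i)%:~R * var_between a b S`_(i.-1) S`_i
    + (chain_eps sigma tau m.+1)%:~R * cauchy_index a b S`_m.+1 S`_m.
  elim: m => [|m IHm] lin.
    by rewrite big_geq // /chain_eps big_geq // mul1r add0r.
  rewrite (IHm (ltnW lin)) (inv _ (ltnW lin)) (sturm_step _ _ hab hS lin) //.
  rewrite [in RHS]big_nat_recr //=.
  (* The minus signs of the inversion and of the chain step cancel, leaving the next factor of
     [chain_eps]. *)
  have -> : chain_eps sigma tau m.+2 = chain_eps sigma tau m.+1 *
      (sigma`_m * tau`_m) by rewrite /chain_eps big_nat_recr.
  by rewrite intrM; ring.
(* A last inversion, with no chain step after it, leaves the index with denominator S_n, which is
   0. *)
have lin : (n.-1 < n)%N by rewrite ltn_predL.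
rewrite (partial _ lin) (inv _ lin) (prednK hn).
rewrite cauchy_indexNroot ?subr0 //; last by case: hS.
by rewrite /chain_var big_nat_recr //= prednK.
Qed.
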